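(* Every ccc branchwise-real tree order with no continuous grading contains a Suslin tree, i.e. has a subset which, with the induced order, is a Suslin tree.
   Context: A tree order is a partial order with a minimum element such that for every $x$ the set $\{y\mid y\le x\}$ is linearly ordered; a branch is a maximal linearly ordered subset. A branchwise-real tree order is a tree order in which every branch is order-isomorphic to a real interval and any two elements have a greatest lower bound. A continuous grading is a strictly monotonic $\ell\colon X\to\mathbb{R}$ whose restriction to each $[x,y]=\{z\mid x\le z\le y\}$ ($x<y$) is an order-isomorphism onto $[\ell(x),\ell(y)]$. An antichain is a set of pairwise incomparable elements; a tree order is ccc if it has no uncountable antichain. A well-stratified tree is a tree order in which each $\{y\mid y\le x\}$ is well-ordered; levels are the sets of elements with a given order type of predecessors, and the height is the least $\alpha$ with empty $\alpha$-th level. A Suslin tree is a ccc well-stratified tree of height $\omega_1$ all of whose levels and branches are countable. *)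

(* Defs.v *)
From HB Require Import structures.
From mathcomp Require Import all_boot all_order all_algebra.
From mathcomp Require Import all_classical wochoice.
From mathcomp Require Import reals.

Set Implicit Arguments.
Unset Strict Implicit.
Unset Printing Implicit Defensive.

Local Open Scope classical_set_scope.
Local Open Scope order_scope.

(* The induced order on a subtype, which the library does not declare: through
   it a subset [A : set T], seen as the type [set_type A] (which unfolds to
   [{x : T | x \in A}]), is an ordered type of its own. *)
HB.instance Definition _ d (T : porderType d) (P : pred T) :=
  [SubChoice_isSubPOrder of {x : T | P x} by <: with d].

Definition order_isomorphic d1 (T : porderType d1) d2 (U : porderType d2) :=
  exists f : T -> U, bijective f /\ {mono f : x y / x <= y}.

Definition tree_order d (T : porderType d) :=
  (exists m : T, forall x, m <= x) /\
  forall x : T, total_on [set y | y <= x] (fun u v => u <= v).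

Definition branch d (T : porderType d) (B : set T) :=
  total_on B (fun u v => u <= v) /\
  forall C : set T, total_on C (fun u v => u <= v) -> B `<=` C -> C = B.

Definition branchwise_real (R : realType) d (T : porderType d) :=
  [/\ tree_order T,
      forall B : set T, branch B ->
        exists I : interval R, order_isomorphic (set_type B) (set_type [set` I])
    & forall x y : T, infimums [set x; y] !=set0].

Definition continuous_grading (R : realType) d (T : porderType d) (l : T -> R) :=
  {homo l : x y / x < y} /\
  forall x y : T, x < y ->
    set_bij [set` `[x, y]] [set` `[l x, l y]] l /\
    {in [set` `[x, y]] &, {mono l : u v / u <= v}}.

Definition antichain d (T : porderType d) (A : set T) :=
  {in A &, forall x y, x != y -> x >< y}.

Definition ccc d (T : porderType d) :=
  forall A : set T, antichain A -> countable A.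

Definition well_stratified d (T : porderType d) :=
  tree_order T /\
  forall x : T, well_order (@Order.le _ (set_type [set y | y <= x])).

(* Ordinals are represented by well-ordered types [W], up to order
   isomorphism; the ordinals below [W] are then the order types of the proper
   initial segments of [W]. *)
Definition ordinal_lt d1 (V : porderType d1) d2 (W : porderType d2) :=
  exists w : W, order_isomorphic V (set_type [set v | v < w]).

(* Predecessors are strict here, so that the minimum is on level 0. *)
Definition level d (T : porderType d) d' (W : porderType d') : set T :=
  [set x | order_isomorphic (set_type [set y | y < x]) W].
Arguments level {d} T {d'} W.

Definition has_height d (T : porderType d) d' (W : porderType d') :=
  [/\ well_order (@Order.le _ W),
      level T W = set0
    & forall d1 (V : porderType d1), ordinal_lt V W -> level T V !=set0].

(* [W] has order type omega_1, the least uncountable ordinal. *)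
Definition is_omega1 d (W : porderType d) :=
  [/\ well_order (@Order.le _ W),
      ~ countable [set: W]
    & forall d1 (V : porderType d1), ordinal_lt V W -> countable [set: V]].

Definition suslin_tree d (T : porderType d) :=
  [/\ ccc T, well_stratified T,
      exists d' (W : porderType d'), is_omega1 W /\ has_height T W,
      forall d' (W : porderType d'),
        well_order (@Order.le _ W) -> countable (level T W)
    & forall B : set T, branch B -> countable B].

(* Main.v *)
(* If some countable D is cofinal in X, then X is continuously gradable: for p
   in D the map x |-> h_p (x /\ p), where h_p embeds {z | z <= p} into [0, 1], is
   monotone and continuous along the order, two points x < y with y <= p are
   separated by it, and so a geometrically weighted sum over D is a grading.

   Otherwise fix a well-order r of X and let S consist of the points x that lie
   below no r-earlier point. S is cofinal, hence uncountable, and on S the order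
   of X is contained in r, hence well-founded. Its chains are well-ordered sets
   of reals, hence countable, and its levels are antichains, hence countable, so
   that S (with the root added) has height omega_1. *)

Require Import Defs.
From HB Require Import structures.
From mathcomp Require Import all_boot all_order all_algebra.
From mathcomp Require Import all_classical wochoice.
From mathcomp Require Import reals.
From mathcomp Require Import lra.

Set Implicit Arguments.
Unset Strict Implicit.
Unset Printing Implicit Defensive.

Import Order.TTheory GRing.Theory Num.Theory.

Local Open Scope classical_set_scope.
Local Open Scope ring_scope.
Local Open Scope order_scope.

(** * Gradings from countable cofinal sets *)

Lemma branch_extension d (T : porderType d) (C : set T) :
  total_on C (fun u v => u <= v) -> exists2 B : set T, branch B & C `<=` B.
Proof.
(* [P] speaks of the union with [C] rather than of containing [C], so that the union of the empty
   family satisfies it too. *)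
move=> Ctot; pose P (B : set T) := total_on (C `|` B) (fun u v => u <= v).
have [|A [PA Amax]] := @Zorn_bigcup T P.
  move=> F FP Ftot s t [Cs|[U FU Us]] [Ct|[V FV Vt]].
  - exact: Ctot.
  - by apply: (FP V FV); [left|right].
  - by apply: (FP U FU); [right|left].
  - case: (Ftot U V FU FV) => UV.
    + by apply: (FP V FV); right=> //; apply: UV.
    + by apply: (FP U FU); right=> //; apply: UV.
exists (C `|` A); last by left.
split=> // D Dtot CAD; apply/seteqP; split=> // x Dx; right.
apply: contrapT => nAx; apply: (Amax D).
  by split=> [y Ay|/(_ x Dx)//]; apply: CAD; right.
by rewrite /P (setUidr (_ : C `<=` D)) // => y Cy; apply: CAD; left.
Qed.

Lemma itv_convex d (T : porderType d) (I : interval T) (u v r : T) :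
  u \in I -> v \in I -> u <= r <= v -> r \in I.
Proof.
case: I => a b; rewrite !itv_boundlr.
move=> /andP[au _] /andP[_ vb] /andP[ur rv].
by rewrite (le_trans au) ?bnd_simp//= (le_trans _ vb) ?bnd_simp.
Qed.

(** The isomorphism is made total by the value 0 off [B]; the second clause is the convexity of [I]
    carried back to [B]. *)
Lemma branch_chart (R : realType) d (X : porderType d) (B : set X)
    (I : interval R) :
  order_isomorphic (set_type B) (set_type [set` I]) ->
  exists h : X -> R, {in B &, {mono h : x y / x <= y}} /\
    forall x y r, B x -> B y -> h x <= r <= h y -> exists2 z, B z & h z = r.
Proof.
move=> [f [[g fK gK] fm]].
pose h (x : X) : R := oapp (fun u : set_type B => val (f u)) 0%R (insub x).
have hE (u : set_type B) : h (val u) = val (f u) by rewrite /h valK.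
exists h; split.
  move=> x y xB yB.
  have -> : x = val (exist _ x xB : set_type B) by [].
  have -> : y = val (exist _ y yB : set_type B) by [].
  by rewrite !hE; exact: fm.
move=> x y r /mem_set xB /mem_set yB.
have -> : x = val (exist _ x xB : set_type B) by [].
have -> : y = val (exist _ y yB : set_type B) by [].
rewrite !hE; set u := f _; set v := f _ => /andP[ur rv].
have rI : r \in [set` I].
  have := valP v; have := valP u; rewrite !inE /= => uI vI.
  by apply: (itv_convex uI vI); rewrite ur.
exists (val (g (exist _ r rI))); first by apply: set_mem; exact: valP.
by rewrite hE gK.
Qed.

Section Grading.
Context (R : realType) d (X : porderType d).
Hypothesis Xbr : branchwise_real R X.

Let comparable_below (p x y : X) : x <= p -> y <= p -> x <= y \/ y <= x.
Proof. by move=> xp yp; case: Xbr => -[_ Xtot] _ _; exact: (Xtot p). Qed.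

(** A chart of a branch through [p] is restricted and rescaled. The branch contains the root, whose
    image bounds the values from below. *)
Lemma lower_chart (p : X) : exists h : X -> R,
  [/\ {in [set z | z <= p] &, {mono h : x y / x <= y}},
      forall z, z <= p -> 0%R <= h z <= 1%R
    & forall x y r, x <= p -> y <= p -> h x <= r <= h y ->
        exists2 z, z <= p & h z = r].
Proof.
case: Xbr => -[[m mmin] Xtot] Xint _.
have [B Bbr pB] := branch_extension (Xtot p).
have [I /branch_chart[h [hm hs]]] := Xint B Bbr.
have hmB x y : B x -> B y -> (h x <= h y) = (x <= y).
  by move=> ? ?; apply: hm; apply: mem_set.
have Bm : B m by apply: pB; exact: mmin.
have Bp : B p by apply: pB => /=.
have mp : h m <= h p by rewrite hmB.
(* The summand 1 keeps [c] positive even when [p] is the root. *)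
pose c := (1 + (h p - h m))%R; have c0 : (0 < c)%R by rewrite /c; lra.
exists (fun z => (h z - h m) / c)%R; split.
- move=> x y /set_mem xp /set_mem yp.
  by rewrite ler_pM2r ?invr_gt0// lerD2r hmB //; exact: pB.
- move=> z zp; have Bz : B z by exact: pB.
  have : h m <= h z by rewrite hmB.
  have : h z <= h p by rewrite hmB.
  move=> zp' mz'; rewrite ler_pdivrMr// ler_pdivlMr// mul0r mul1r /c.
  by apply/andP; split; lra.
- move=> x y r xp yp; rewrite ler_pdivrMr// ler_pdivlMr// => /andP[xr ry].
  have [|z Bz hz] := hs x y (r * c + h m)%R (pB _ xp) (pB _ yp).
    by apply/andP; split; lra.
  exists z; last by rewrite hz addrK mulfK// gt_eqF.
  by apply: (le_trans _ yp); rewrite -hmB//; [lra|exact: pB].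
Qed.

(** Take the real supremum in the chart of [y] and pull it back, which is possible because the image
    of the chart is convex. *)
Lemma interval_lub (x y : X) (A : set X) :
  A x -> (forall z, A z -> z <= y) ->
  exists s, [/\ x <= s, s <= y, forall z, A z -> z <= s
    & forall u, u <= y -> (forall z, A z -> z <= u) -> s <= u].
Proof.
move=> Ax Ay; have [h [hm h01 hs]] := lower_chart y.
have hmB u v : u <= y -> v <= y -> (h u <= h v) = (u <= v).
  by move=> ? ?; apply: hm; apply: mem_set.
have supA : has_sup (h @` A).
  by split; [exists (h x), x|exists (h y) => _ [z Az <-]; rewrite hmB// Ay].
have hle z : A z -> h z <= sup (h @` A).
  by move=> Az; apply: ub_le_sup; [case: supA|exists z].
have supy : sup (h @` A) <= h y.
  by apply: ge_sup; [case: supA|move=> _ [z Az <-]; rewrite hmB// Ay].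
have [|s sy hsE] := hs x y (sup (h @` A)) (Ay _ Ax) (lexx y).
  by rewrite hle.
exists s; split=> //.
- by rewrite -hmB// ?hsE ?hle//; exact: Ay.
- by move=> z Az; rewrite -hmB// ?hsE ?hle//; exact: Ay.
- move=> u uy uA; rewrite -hmB// hsE; apply: ge_sup; first by case: supA.
  by move=> _ [z Az <-]; rewrite hmB// ?uA//; exact: Ay.
Qed.

(* For a monotone [f] this is continuity along the order; phrased without a
   topology, it passes to uniform limits and yields intermediate values. *)
Definition jumpless (f : X -> R) := forall x y e, x < y -> (0 < e)%R ->
  (exists2 z, x < z <= y & (f z < f x + e)%R) /\
  (exists2 z, x <= z < y & (f y < f z + e)%R).

(** An intermediate value argument: the supremum [s] of the points below [y] with value at most [t]
    has value [t], since a smaller or larger value would force a jump just after or just before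
    [s]. *)
Lemma jumpless_grading (l : X -> R) :
  {homo l : x y / x < y} -> jumpless l -> continuous_grading l.
Proof.
move=> lt_l lj; split=> // x y xy.
have le_l : {homo l : u v / u <= v}.
  by move=> u v; rewrite le_eqVlt => /predU1P[->//|/lt_l/ltW].
have lm u v : u <= y -> v <= y -> (l u <= l v) = (u <= v).
  move=> uy vy; apply/idP/idP => [|/le_l//].
  case: (comparable_below uy vy) => // vu; have [->//|nuv] := eqVneq u v.
  by rewrite leNgt lt_l// lt_neqAle eq_sym nuv.
have mono_l : {in [set` `[x, y]] &, {mono l : u v / u <= v}}.
  move=> u v; rewrite !inE /= !in_itv /= => /andP[_ uy] /andP[_ vy].
  exact: lm.
split=> //; split.
- by move=> u /=; rewrite !in_itv /= => /andP[xu uy]; rewrite !le_l.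
- move=> u v uxy vxy luv; apply/le_anti.
  by rewrite -mono_l// luv lexx -mono_l// luv lexx.
move=> t /=; rewrite in_itv /= => /andP[xt ty].
pose A := [set z | z <= y /\ l z <= t].
have [||s [xs sy As smin]] := @interval_lub x y A.
- by split=> //; exact: ltW.
- by move=> z [].
exists s; first by rewrite /= in_itv /= xs.
apply/eqP; case: ltgtP => // st.
- have lt_sy : s < y.
    by rewrite lt_neqAle sy andbT; apply: contraTneq st => ->; rewrite -leNgt.
  have [|[z /andP[sz zy] lz] _] := lj s y (t - l s)%R lt_sy.
    by rewrite subr_gt0.
  suff : z <= s by rewrite lt_geF.
  by apply: As; split=> //; move: lz; rewrite addrC subrK => /ltW.
- have lt_xs : x < s.
    rewrite lt_neqAle xs andbT; apply: contraTneq st => <-.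
    by rewrite -leNgt.
  have [|_ [z /andP[xz zs] lz]] := lj x s (l s - t)%R lt_xs.
    by rewrite subr_gt0.
  have tz : (t < l z)%R by lra.
  suff : s <= z by rewrite lt_geF.
  apply: smin; first exact/(le_trans (ltW zs)).
  move=> u [uy lu]; rewrite -lm //; last exact/(le_trans (ltW zs)).
  exact: le_trans lu (ltW tz).
Qed.

(** Each summand gets half of [e]. The two witnesses lie below [y], hence are comparable, and by
    monotonicity the one nearer to the endpoint in question serves both summands. *)
Lemma jumpless_addMl (f g : X -> R) (c : R) : (0 < c)%R ->
  {homo f : x y / x <= y} -> {homo g : x y / x <= y} ->
  jumpless f -> jumpless g -> jumpless (fun x => f x + c * g x)%R.
Proof.
move=> c0 fm gm fj gj x y e xy e0.
have e20 : (0 < e / 2)%R by lra.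
have ec0 : (0 < e / 2 / c)%R by rewrite divr_gt0.
have [[z1 /andP[xz1 z1y] fz1] [z2 /andP[xz2 z2y] fz2]] := fj x y _ xy e20.
have [[w1 /andP[xw1 w1y] gw1] [w2 /andP[xw2 w2y] gw2]] := gj x y _ xy ec0.
have {}gw1 : (c * g w1 < c * g x + e / 2)%R.
  by move: gw1; rewrite -(ltr_pM2l c0) mulrDr mulrCA divff ?mulr1 // gt_eqF.
have {}gw2 : (c * g y < c * g w2 + e / 2)%R.
  by move: gw2; rewrite -(ltr_pM2l c0) mulrDr mulrCA divff ?mulr1 // gt_eqF.
split.
- case: (comparable_below z1y w1y) => zw.
  + exists z1; rewrite ?xz1//.
    by have := gm _ _ zw; rewrite -(ler_pM2l c0) => ?; lra.
  + by exists w1; rewrite ?xw1//; have := fm _ _ zw => ?; lra.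
- case: (comparable_below (ltW z2y) (ltW w2y)) => zw.
  + by exists w2; rewrite ?xw2//; have := fm _ _ zw => ?; lra.
  + exists z2; rewrite ?xz2//.
    by have := gm _ _ zw; rewrite -(ler_pM2l c0) => ?; lra.
Qed.

Lemma ramp (p : X) : exists f : X -> R,
  [/\ {homo f : x y / x <= y}, forall z, 0%R <= f z <= 1%R, jumpless f
    & forall x y, x < y -> y <= p -> f x < f y].
Proof.
have [h [hm h01 hs]] := lower_chart p.
have hmB u v : u <= p -> v <= p -> (h u <= h v) = (u <= v).
  by move=> ? ?; apply: hm; apply: mem_set.
have hltB u v : u <= p -> v <= p -> (h u < h v) = (u < v).
  by move=> up vp; rewrite !lt_leAnge !hmB.
have /choice[q qinf] : forall x, exists q, infimums [set x; p] q.
  by move=> x; case: Xbr => _ _; apply.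
have qx x : q x <= x by have [+ _] := qinf x; apply; left.
have qp x : q x <= p by have [+ _] := qinf x; apply; right.
have qmax x u : u <= x -> u <= p -> u <= q x.
  by move=> ux up; have [_ +] := qinf x; apply=> v [->|->].
have qid x : x <= p -> q x = x by move=> xp; apply: le_anti; rewrite qx qmax.
have qm : {homo q : x y / x <= y}.
  by move=> x y xy; apply: qmax => //; exact: le_trans (qx x) xy.
exists (h \o q); split => /=.
- by move=> x y xy; rewrite hmB// qm.
- by move=> z; exact: h01.
- move=> x y e xy e0 /=; split.
  (* If [q y <= x], then [q] agrees at [x] and [y], and an endpoint is a witness. Otherwise
     [x < q y <= p], and the chart of [p] covers the segment from [x] to [q y]. *)
  + have [qyx|nqyx] := boolP (q y <= x).
      exists y; first by rewrite xy lexx.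
      suff -> : q y = q x by rewrite ltrDl.
      by apply: le_anti; rewrite (qm _ _ (ltW xy)) qmax.
    have xq : x < q y.
      case: (comparable_below (ltW xy) (qx y)) => [|/(negP nqyx)//].
      rewrite le_eqVlt => /predU1P[xqy|//].
      by rewrite -xqy lexx in nqyx.
    have xp : x <= p by exact: le_trans (ltW xq) (qp y).
    pose r := Num.min (h x + e / 2)%R (h (q y)).
    have hxq : h x < h (q y) by rewrite hltB.
    have [|z zp hz] := hs x (q y) r xp (qp y).
      by rewrite /r le_min ge_min lexx orbT (ltW hxq) !andbT; lra.
    exists z; last by rewrite !qid// hz /r gt_min; apply/orP; left; lra.
    rewrite -hltB// hz /r lt_min hxq andbT; apply/andP; split; first lra.
    apply: le_trans (qx y); rewrite -hmB// hz /r.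
    by rewrite ge_min lexx orbT.
  + have [qyx|nqyx] := boolP (q y <= x).
      exists x; first by rewrite xy lexx.
      suff -> : q y = q x by rewrite ltrDl.
      by apply: le_anti; rewrite (qm _ _ (ltW xy)) qmax.
    have xq : x < q y.
      case: (comparable_below (ltW xy) (qx y)) => [|/(negP nqyx)//].
      rewrite le_eqVlt => /predU1P[xqy|//].
      by rewrite -xqy lexx in nqyx.
    (* Between [q y] and [y] the function is flat, so [q y] itself is a witness unless [y <= p]. *)
    have [qy|nqy] := eqVneq (q y) y; last first.
      exists (q y); last by rewrite (qid (q y))// ltrDl.
      by rewrite (ltW xq) lt_neqAle nqy qx.
    have yp : y <= p by rewrite -qy.
    have xp : x <= p by exact: le_trans (ltW xy) yp.
    have hxy : h x < h y by rewrite hltB.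
    pose r := Num.max (h y - e / 2)%R (h x).
    have [|z zp hz] := hs x y r xp yp.
      by rewrite /r ge_max le_max lexx orbT (ltW hxy) !andbT; lra.
    exists z.
      rewrite -hmB// hz /r le_max lexx orbT /= -hltB// hz /r gt_max hxy andbT.
      lra.
    by rewrite !qid// hz /r -ltrBlDr lt_max; apply/orP; left; lra.
- move=> x y xy yp; rewrite !qid// ?hltB//; exact: le_trans (ltW xy) yp.
Qed.
(** The partial sums with weights [w] increase to [l] and stay within [2 ^- N] of it, so
    jumplessness passes to [l]. Strictness survives because every later summand is monotone. *)
Lemma separating_ramps_grading (f : nat -> X -> R) :
  (forall n, {homo f n : x y / x <= y}) ->
  (forall n z, 0%R <= f n z <= 1%R) ->
  (forall n, jumpless (f n)) ->
  (forall x y, x < y -> exists n, f n x < f n y) ->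
  exists l : X -> R, continuous_grading l.
Proof.
move=> fm f01 fj fsep.
pose w n : R := (2 ^- n.+1)%R.
have w0 n : (0 < w n)%R by rewrite /w invr_gt0 exprn_gt0.
pose S N z := (\sum_(i < N) w i * f i z)%R.
have SS N z : S N.+1 z = (S N z + w N * f N z)%R by rewrite /S big_ord_recr.
have wf0 N z : (0 <= w N * f N z)%R.
  by apply: mulr_ge0; [exact: ltW|case/andP: (f01 N z)].
have Sle M N z : (M <= N)%N -> (S M z <= S N z)%R.
  move=> /subnK <-; elim: (N - M)%N => // k IH; rewrite addSn SS.
  by apply: le_trans IH _; rewrite lerDl.
(* The partial sum plus the total of all remaining weights can only decrease. *)
have Stail M N z : (M <= N)%N -> (S N z + 2 ^- N <= S M z + 2 ^- M)%R.
  move=> /subnK <-; elim: (N - M)%N => // k IH; rewrite addSn SS.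
  apply: le_trans _ IH; rewrite -addrA lerD2l.
  have -> : (2 ^- (k + M) = w (k + M)%N + w (k + M)%N :> R)%R.
    by rewrite /w exprS invfM -mulrDl -[LHS]mul1r; congr (_ * _)%R; lra.
  rewrite lerD2r -[leRHS]mulr1 ler_pM2l//.
  by case/andP: (f01 (k + M)%N z).
have e2 N : (0 < 2 ^- N :> R)%R by rewrite invr_gt0 exprn_gt0.
have Sub N z : (forall M, S M z <= S N z + 2 ^- N)%R.
  move=> M; case: (leqP M N) => MN.
    by apply: le_trans (Sle _ _ z MN) _; rewrite lerDl ltW.
  by apply: le_trans (Stail _ _ z (ltnW MN)); rewrite lerDl ltW.
pose l z := sup (range (S^~ z)).
have Sl N z : S N z <= l z.
  apply: ub_le_sup; last by exists N.
  by exists (S 0 z + 2 ^- 0)%R => _ [M _ <-].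
have lS N z : l z <= (S N z + 2 ^- N)%R.
  by apply: ge_sup; [exists (S 0 z), 0%N|move=> _ [M _ <-]].
have Sm N : {homo S N : x y / x <= y}.
  move=> x y xy; apply: ler_sum => i _.
  by rewrite ler_pM2l//; exact: fm.
have Sj N : jumpless (S N).
  elim: N => [|N IH].
    move=> x y e xy e0; split; [exists y|exists x];
      by rewrite ?xy ?lexx// /S !big_ord0 add0r.
  have -> : S N.+1 = fun z => (S N z + w N * f N z)%R by apply/funext => z.
  exact: jumpless_addMl.
exists l; apply: jumpless_grading => //.
  move=> x y xy; have [n fxy] := fsep x y xy.
  pose c := (S n.+1 y - S n.+1 x)%R.
  have c0 : (0 < c)%R.
    rewrite /c !SS; have := Sm n _ _ (ltW xy).
    have : (w n * f n x < w n * f n y)%R by rewrite ltr_pM2l.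
    by move=> ? ?; lra.
  have cS M : (n.+1 <= M)%N -> (c <= S M y - S M x)%R.
    move=> /subnK <-; elim: (M - n.+1)%N => // k IH; rewrite addSn !SS.
    have : (w (k + n.+1)%N * f (k + n.+1)%N x <=
            w (k + n.+1)%N * f (k + n.+1)%N y)%R.
      by rewrite ler_pM2l//; exact: fm (ltW xy).
    by move=> ?; lra.
  suff : (l x <= l y - c)%R by lra.
  apply: ge_sup; first by exists (S 0 x), 0%N.
  (* [K] is late enough both to dominate [S M] and to have collected the increment [c]. *)
  move=> _ [M _ <-]; pose K := maxn M n.+1.
  have := cS K (leq_maxr _ _); have := Sle _ _ x (leq_maxl M n.+1).
  by have := Sl K y; rewrite -/K => ? ? ?; lra.
(* Since [2 / e < N < 2 ^ N], the error of the [N]-th partial sum is below [e / 2]. *)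
move=> x y e xy e0; pose N := Num.bound (2 / e)%R.
have Ne : (2 ^- N < e / 2)%R.
  have eN : (2 / e < 2 ^+ N :> R)%R.
    apply: lt_trans (_ : (N%:R < 2 ^+ N)%R).
      by apply: archi_boundP; rewrite divr_ge0 ?ltW.
    by rewrite -natrX ltr_nat ltn_expl.
  rewrite -[ltRHS]invrK ltf_pV2 ?posrE ?exprn_gt0 ?invr_gt0 ?divr_gt0//.
  by rewrite invfM invrK mulrC.
have e20 : (0 < e / 2)%R by lra.
have [[z1 xz1 Sz1] [z2 xz2 Sz2]] := Sj N x y _ xy e20.
split; [exists z1|exists z2] => //.
  by have := lS N z1; have := Sl N x; lra.
by have := lS N y; have := Sl N z2; lra.
Qed.

Lemma countable_cofinal_grading (D : set X) :
  countable D -> (forall x, exists2 p, D p & x <= p) ->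
  exists l : X -> R, continuous_grading l.
Proof.
move=> /pfcard_geP[D0|[p]] Dcof.
  (* The root lies below some point of [D], so [D] cannot be empty. *)
  case: (Xbr) => -[[m _] _] _ _; have [q] := Dcof m.
  by rewrite D0.
have /choice[f fP] n := ramp (p n).
apply: (@separating_ramps_grading f).
- by move=> n; case: (fP n).
- by move=> n; case: (fP n).
- by move=> n; case: (fP n).
- move=> x y xy; have [q Dq yq] := Dcof y.
  have [n _ pn] := @surj _ _ _ _ p q Dq.
  by exists n; case: (fP n) => _ _ _; apply=> //; rewrite pn.
Qed.
End Grading.

(** * Well-founded ccc trees *)

Lemma well_orderP d (T : porderType d) : well_order (@Order.le _ T) <->
  forall A : set T, A !=set0 -> exists2 m, A m & forall x, A x -> m <= x.
Proof.
split=> [wo A [x Ax]|min].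
  have [|m [[mA mlb] _]] := wo (mem A); first by exists x; rewrite inE.
  by exists m; [exact: set_mem|move=> y Ay; apply: mlb; exact: mem_set].
apply: antisymmetric_well_order; first exact: le_anti.
move=> A [x xA]; have [|m Am mlb] := min [set z | z \in A]; first by exists x.
by exists m; split.
Qed.

(** Transitivity is read off from which of the three points is their minimum. *)
Lemma well_order_total_order (T : eqType) (r : rel T) :
  well_order r -> total_order r.
Proof.
move=> wo; have rwo : wo_chain r predT by exact: withinW.
have rtot : total r by move=> x y; exact: (wo_chainW rwo).
have ranti : antisymmetric r by move=> x y; exact: (wo_chain_antisymmetric rwo).
split=> //; split=> //; split.
  by move=> x; exact: (wo_chain_reflexive rwo).
move=> y x z xy yz.
have [|m [[+ mlb] _]] := wo [pred t | [|| t == x, t == y | t == z]].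
  by exists x; rewrite inE eqxx.
rewrite !inE => /or3P[] /eqP mE; subst m.
- by apply: mlb; rewrite !inE eqxx !orbT.
- by rewrite (ranti x y) // xy mlb // !inE eqxx.
- by rewrite -(ranti y z) // yz mlb // !inE eqxx orbT.
Qed.

Lemma countable_set_type (T : choiceType) (A : set T) :
  countable [set: set_type A] <-> countable A.
Proof. by rewrite (eq_countable (card_setT _)). Qed.

Lemma countable_image_inj (T U : Type) (f : T -> U) (A : set T) :
  {in A &, injective f} -> countable (f @` A) -> countable A.
Proof. by move=> fi; rewrite (eq_countable (inj_card_eq fi)). Qed.

Lemma countable_setU (T : Type) (A B : set T) :
  countable A -> countable B -> countable (A `|` B).
Proof.
move=> cA cB; rewrite -bigcup2E; apply: bigcup_countable => // -[|[|n]] _ //=.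
Qed.

(** * Order isomorphisms and the ordinal omega_1 *)

Lemma order_isomorphic_sym d1 (V : porderType d1) d2 (W : porderType d2) :
  order_isomorphic V W -> order_isomorphic W V.
Proof.
move=> [f [[g fK gK] fm]]; exists g; split; first by exists f.
by move=> x y; rewrite -fm !gK.
Qed.

Lemma order_isomorphic_trans d1 (U : porderType d1) d2 (V : porderType d2)
    d3 (W : porderType d3) :
  order_isomorphic U V -> order_isomorphic V W -> order_isomorphic U W.
Proof.
move=> [f [fb fm]] [g [gb gm]]; exists (g \o f); split; first exact: bij_comp.
by move=> x y /=; rewrite gm fm.
Qed.

Lemma order_isomorphic_countable d1 (V : porderType d1) d2 (W : porderType d2) :
  order_isomorphic V W -> countable [set: W] -> countable [set: V].
Proof.
move=> [f [/bij_inj finj _]] cW; apply: (@countable_image_inj _ _ f).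
  by move=> x y _ _; exact: finj.
by apply: sub_countable cW; exact: card_leT.
Qed.

(* omega_1 is the set of points with countably many predecessors in some
   well-order of [T]. *)
Lemma omega1_exists (T : choiceType) : ~ countable [set: T] ->
  exists d (W : porderType d), is_omega1 W.
Proof.
move=> uT; have [r rwo] := well_ordering_principle T.
have [[[rxx rtr] ranti] rtot] := well_order_total_order rwo.
pose S := [set t | countable [set s | r s t]].
pose U := {t : T | t \in S}.
pose leU (u v : U) := r (val u) (val v).
have leUxx : reflexive leU by move=> u; exact: rxx.
have leUanti : antisymmetric leU by move=> u v /ranti/val_inj.
have leUtr : transitive leU by move=> u v w; exact: rtr.
pose W : porderType (Order.Disp tt tt) :=
  HB.pack U (@Order.Le_isPOrder.Build (Order.Disp tt tt) U
               leU leUxx leUanti leUtr).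
exists _, W; split.
- apply/well_orderP => A [u Au].
  have [|m [[mA mlb] _]] := rwo [pred t | t \in val @` (A : set U)].
    by exists (val u); rewrite inE; exists u.
  move: mA; rewrite inE => -[v Av vm]; exists v => // w Aw.
  by rewrite /Order.le /= /leU vm; apply: mlb; rewrite inE; exists w.
- move=> /(countable_set_type S) cS.
  have [t nSt] : exists t, ~ S t.
    apply: contrapT => /forallNP nS; apply: uT.
    by apply: sub_countable cS; apply: subset_card_le => t _; exact: contrapT.
  (* The predecessors of the least point [t0] outside [S] lie in [S] or equal [t0]; if [S] is
     countable, this puts [t0] into [S]. *)
  have [|t0 [[]]] := rwo [pred t | t \notin S].
    by exists t; rewrite inE; apply/negP => /set_mem.
  rewrite inE => /negP + tlb _; apply; apply: mem_set.
  apply: (@sub_countable _ _ _ (S `|` [set t0])); last first.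
    exact: countable_setU cS (countable1 _).
  apply: subset_card_le => s /= st0; have [/set_mem|sS] := boolP (s \in S).
    by left.
  by right; apply: ranti; rewrite st0 tlb.
- move=> d1 V [w /order_isomorphic_countable]; apply.
  apply/countable_set_type; apply: (@countable_image_inj _ _ (val : U -> T)).
    by move=> x y _ _; exact: val_inj.
  apply: (@sub_countable _ _ _ [set s | r s (val (w : U))]).
    by apply: subset_card_le => _ [v /= /ltW vw <-].
  by apply: set_mem; exact: (valP (w : U)).
Qed.

Section Omega1.
Context d (W : porderType d).
Hypothesis Womega : is_omega1 W.

Lemma omega1_segment (w : W) : countable [set v | v < w].
Proof.
apply/countable_set_type; case: Womega => _ _; apply; exists w.
by exists id; split=> //; exists id.
Qed.

Lemma omega1_total (v w : W) : v <= w \/ w < v.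
Proof.
case: Womega => /well_order_total_order[_ tot] _ _.
have /orP[|] := tot v w; first by left.
by rewrite le_eqVlt => /predU1P[->|]; [left|right].
Qed.

(** Otherwise the initial segments up to the points of [A], countably many and each countable, would
    cover [W]. *)
Lemma omega1_bounded (A : set W) : countable A ->
  exists w, forall a, A a -> a < w.
Proof.
move=> cA; apply: contrapT => /forallNP unb; case: Womega => _ + _; apply.
apply: (@sub_countable _ _ _ (\bigcup_(a in A) ([set v | v < a] `|` [set a]))).
  apply: subset_card_le => w _; have /existsNP[a /not_implyP[Aa naw]] := unb w.
  exists a => //; case: (omega1_total w a) => //.
  by rewrite le_eqVlt => /predU1P[->|]; [right|left].
apply: bigcup_countable => // a _.
exact: countable_setU (omega1_segment a) (countable1 a).
Qed.
End Omega1.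

(** * Well-founded orders and ranks *)

Definition founded d (T : porderType d) :=
  forall A : set T, A !=set0 -> exists2 m, A m & forall x, A x -> ~ x < m.

Lemma founded_wf d (T : porderType d) :
  founded T -> well_founded (fun y x : T => y < x).
Proof.
move=> Tf x; apply: contrapT => nAx.
have [|m nAm mmin] := Tf [set x | ~ Acc (fun y x : T => y < x) x].
  by exists x.
by apply: nAm; constructor => y ym; apply: contrapT => /mmin.
Qed.

(* The hypothesis on [x] is there because [W] need not have an element above all
   the ranks below [x]. *)
Lemma rank_exists d (T : porderType d) d' (W : porderType d') (w0 : W) :
  founded T -> well_order (@Order.le _ W) ->
  exists rk : T -> W, forall x, (exists w, forall y, y < x -> rk y < w) ->
    (forall y, y < x -> rk y < rk x) /\
    forall w, (forall y, y < x -> rk y < w) -> rk x <= w.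
Proof.
move=> /founded_wf Twf /well_orderP Wwo.
(* The default [w0] is returned only for the empty set, which the bound assumed at [x] rules out. *)
pose least (A : set W) := xget w0 [set m | A m /\ forall x, A x -> m <= x].
pose F x (rec : forall y : T, y < x -> W) :=
  least [set w | forall y (yx : y < x), rec y yx < w].
pose rk := Fix Twf (fun=> W) F.
have rkE x : rk x = least [set w | forall y, y < x -> rk y < w].
  rewrite {1}/rk Fix_eq // => z f g fg; congr (F z _).
  by apply/functional_extensionality_dep => y; apply/funext => yz.
exists rk => x [w wP]; rewrite rkE /least.
case: xgetP => [m _ [Am mlb]|no]; first by split.
have [|m Am mlb] := Wwo [set w | forall y, y < x -> rk y < w].
  by exists w.
by case: (no m).
Qed.

(** Well-foundedness leaves a gap in the line between each point of [C] and all later ones; a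
    rational chosen in each gap is an injective label. *)
Lemma countable_well_ordered_embedding (R : realType) d (T : porderType d)
    (C : set T) (h : T -> R) :
  total_on C (fun u v => u <= v) -> founded T ->
  {in C &, {mono h : x y / x <= y}} -> countable C.
Proof.
move=> Ctot Tf hm.
have hlt x y : C x -> C y -> (h x < h y) = (x < y).
  by move=> Cx Cy; rewrite !lt_leAnge !hm ?inE.
have /choice[q qP] : forall c, exists q : rat, C c ->
    h c < ratr q /\ forall c', C c' -> c < c' -> ratr q < h c'.
  move=> c; have [Cc|nC] := pselect (C c); last by exists 0%R.
  (* A last point of [C] has no successor, and any rational in the next unit interval will do. *)
  have [[x [Cx cx]]|nsucc] := pselect (exists x, C x /\ c < x); last first.
    have [|q] := @rat_in_itvoo R (h c) (h c + 1)%R; first by rewrite ltrDl.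
    rewrite in_itv /= => /andP[cq _]; exists q => _; split=> // c' Cc' cc'.
    by case: nsucc; exists c'.
  have [|s [Cs cs] smin] := Tf [set x | C x /\ c < x]; first by exists x.
  have [|q] := @rat_in_itvoo R (h c) (h s); first by rewrite hlt.
  rewrite in_itv /= => /andP[cq qs]; exists q => _; split=> // c' Cc' cc'.
  apply: lt_le_trans qs _; rewrite hm ?inE//.
  case: (Ctot s c' Cs Cc') => //; rewrite le_eqVlt => /predU1P[->//|c's].
  by case: (smin c').
apply: (@countable_image_inj _ _ q) => // x y /set_mem Cx /set_mem Cy qxy.
have qlt u v : C u -> C v -> q u = q v -> ~ u < v.
  move=> Cu Cv quv uv; have [_ /(_ v Cv uv)] := qP u Cu.
  by rewrite quv; have [vq _] := qP v Cv; rewrite lt_gtF.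
have [] := Ctot x y Cx Cy; rewrite le_eqVlt => /predU1P[//|lt].
  by case: (qlt x y).
by case: (qlt y x).
Qed.

(** * A criterion for Suslin trees *)

Section SuslinTree.
Context d (T : porderType d).
Hypotheses (Tccc : ccc T) (Ttree : tree_order T) (Tfounded : founded T).
Hypothesis Tchain :
  forall C : set T, total_on C (fun u v => u <= v) -> countable C.
Hypothesis Tuncountable : ~ countable [set: T].

Let comparable_below (p x y : T) : x <= p -> y <= p -> x <= y \/ y <= x.
Proof. by move=> xp yp; case: Ttree => _ Ttot; exact: (Ttot p). Qed.

Lemma countable_below (x : T) : countable [set y | y < x].
Proof.
apply: Tchain => y z /ltW yx /ltW zx; exact: comparable_below yx zx.
Qed.

(* An isomorphism from [{z < y}] onto [{z < x}] is strictly increasing on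
   [{z < y}] and moves [x] down; a minimal point moved down is contradictory. *)
Lemma lower_segments_not_isomorphic (x y : T) : x < y ->
  ~ order_isomorphic (set_type [set z | z < y]) (set_type [set z | z < x]).
Proof.
move=> xy [f [_ fm]]; pose V := set_type [set z | z < y].
have below (u : V) : val u < y by have /set_mem := valP u.
have fbelow (u : V) : val (f u) < x by have /set_mem := valP (f u).
have fy (u : V) : val (f u) < y by exact: lt_trans (fbelow u) xy.
pose g (u : V) : V := exist _ (val (f u)) (mem_set (fy u)).
have gm : {mono g : u v / u <= v} by move=> u v; exact: (fm u v).
have glt u v : u < v -> g u < g v by rewrite !lt_leAnge !gm.
pose x' : V := exist _ x (mem_set xy).
have [|z [u gu <-] umin] := Tfounded
  (A := [set z | exists2 u : V, g u < u & val u = z]).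
  by exists x; exists x' => //; exact: fbelow.
by apply: (umin (val (g u))) => //; exists (g u) => //; exact: glt.
Qed.

(** A level is an antichain, as two comparable points on it would have isomorphic lower segments. *)
Lemma countable_level d' (W : porderType d') : countable (level T W).
Proof.
apply: Tccc => x y /set_mem xW /set_mem yW xy.
have nlt u v : level T W u -> level T W v -> ~ u < v.
  move=> uW vW uv; apply: (lower_segments_not_isomorphic uv).
  exact: order_isomorphic_trans vW (order_isomorphic_sym uW).
apply/negP => /orP[] xy'.
  by apply: (nlt x y) => //; rewrite lt_neqAle xy.
by apply: (nlt y x) => //; rewrite lt_neqAle eq_sym xy.
Qed.

Section Height.
Context d' (W : porderType d').
Hypothesis Womega : is_omega1 W.

(** Ranks exist in [W] because a point has countably many predecessors and countable subsets of
    omega_1 are bounded. If a value were missed, all ranks would lie below it, and [T] would be a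
    countable union of rank fibres, which are antichains. *)
Lemma rank_onto : exists rk : T -> W,
  [/\ {homo rk : x y / x < y},
      forall x w, w < rk x -> exists2 y, y < x & rk y = w
    & forall w, exists x, rk x = w].
Proof.
have [Wwo Wunc _] := Womega.
have [w0 _] : [set: W] !=set0.
  by apply/set0P; apply: contra_notN Wunc => /eqP->; exact: countable0.
have [rk rkP] := rank_exists w0 Tfounded Wwo.
have rkb x : exists w, forall y, y < x -> rk y < w.
  have [|w wP] := omega1_bounded Womega (A := rk @` [set y | y < x]).
    by apply: sub_countable (countable_below x); exact: card_image_le.
  by exists w => y yx; apply: wP; exists y.
have rk_lt : {homo rk : x y / x < y} by move=> x y; apply: (rkP y (rkb y)).1.
have rk_least x w : (forall y, y < x -> rk y < w) -> rk x <= w.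
  exact: (rkP x (rkb x)).2.
have rk_seg x w : w < rk x -> exists2 y, y < x & rk y = w.
  elim/(well_founded_ind (founded_wf Tfounded)) : x => x IH wx.
  (* Some predecessor has rank at least [w], or else [rk x] would be at most [w]. *)
  have [y /not_implyP[yx /negP nyw]] : exists y, ~ (y < x -> rk y < w).
    apply/existsNP => /rk_least; by rewrite lt_geF.
  have [wy|//] := omega1_total Womega w (rk y); last by rewrite (negPf nyw).
  move: wy; rewrite le_eqVlt => /predU1P[->|wy]; first by exists y.
  by have [z zy <-] := IH y yx wy; exists z => //; exact: lt_trans zy yx.
exists rk; split=> // w; apply: contrapT => /forallNP nw.
have rkw x : rk x < w.
  have [wx|//] := omega1_total Womega w (rk x).
  move: wx; rewrite le_eqVlt => /predU1P[wE|/rk_seg[y _ yw]].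
    by case: (nw x).
  by case: (nw y).
apply: Tuncountable.
apply: (@sub_countable _ _ _ (\bigcup_(v in [set v | v < w]) rk @^-1` [set v])).
  by apply: subset_card_le => x _; exists (rk x) => //; exact: rkw.
apply: bigcup_countable => [|v _]; first exact: omega1_segment.
apply: Tccc => x y /set_mem xv /set_mem yv xy; apply/negP => /orP[] le.
  have /rk_lt : x < y by rewrite lt_neqAle xy.
  by rewrite xv yv ltxx.
have /rk_lt : y < x by rewrite lt_neqAle eq_sym xy.
by rewrite xv yv ltxx.
Qed.

(** A point on level [W] would have uncountably many predecessors. For the levels below, the rank
    maps the predecessors of a point of rank [w] isomorphically onto the segment below [w]. *)
Lemma height_omega1 : has_height T W.
Proof.
have [Wwo Wunc _] := Womega; have [rk [rk_lt rk_seg rk_onto]] := rank_onto.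
split=> //.
  apply/seteqP; split=> // x /order_isomorphic_sym/order_isomorphic_countable.
  by move=> cW; apply: Wunc; apply: cW; apply/countable_set_type;
    exact: countable_below.
move=> d1 V [w Vw]; have [x xw] := rk_onto w; exists x.
apply: order_isomorphic_trans (order_isomorphic_sym Vw); rewrite -xw.
pose U := set_type [set y | y < x].
have below (u : U) : val u < x by have /set_mem := valP u.
have rkb (u : U) : rk (val u) \in [set v | v < rk x].
  by apply: mem_set; exact: rk_lt.
pose f (u : U) : set_type [set v | v < rk x] := SigSub (rkb u).
have fm : {mono f : u v / u <= v}.
  have flt (u v : U) : u < v -> f u < f v by exact: rk_lt.
  move=> u v; apply/idP/idP; last first.
    by rewrite le_eqVlt => /predU1P[->//|/flt/ltW].
  have [//|vu] := comparable_below (ltW (below u)) (ltW (below v)).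
  have [->//|nuv] := eqVneq u v.
  by rewrite lt_geF //; apply: flt; rewrite lt_neqAle eq_sym nuv.
exists f; split=> //; rewrite -setTT_bijective; split=> //.
- move=> u v _ _ uv; apply/le_anti; by rewrite -!fm uv lexx.
- move=> v _; have /set_mem /rk_seg[y yx yv] := valP v.
  by exists (exist _ y (mem_set yx)) => //; apply: val_inj.
Qed.
End Height.

Lemma suslin_treeI : suslin_tree T.
Proof.
split=> //.
- split=> // x; apply/well_orderP => A [u Au].
  have [|_ [v Av <-] vmin] := Tfounded (A := val @` A).
    by exists (val u); exists u.
  exists v => // w Aw; have /set_mem vx := valP v; have /set_mem wx := valP w.
  have [//|] := comparable_below vx wx.
  rewrite le_eqVlt => /predU1P[/val_inj->//|wv].
  by case: (vmin (val w)) => //; exists w.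
- have [d' [W Womega]] := omega1_exists Tuncountable.
  by exists d', W; split=> //; exact: height_omega1.
- by move=> d' W _; exact: countable_level.
- by move=> B [Btot _]; exact: Tchain.
Qed.
End SuslinTree.

(** * A well-founded cofinal subset *)

(** The chart of a branch of [X] containing the chain embeds it in the line. *)
Lemma chain_countable (R : realType) d (X : porderType d) (S : set X)
    (C : set (set_type S)) :
  branchwise_real R X -> founded (set_type S) ->
  total_on C (fun u v => u <= v) -> countable C.
Proof.
move=> [_ Xint _] Sf Ctot.
have [|B Bbr CB] := @branch_extension _ X (val @` C).
  by move=> _ _ [u Cu <-] [v Cv <-]; exact: Ctot.
have [I /branch_chart[h [hm _]]] := Xint B Bbr.
apply: (countable_well_ordered_embedding (h := h \o val) Ctot Sf).
move=> u v /set_mem Cu /set_mem Cv /=.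
by rewrite hm // inE; apply: CB; [exists u|exists v].
Qed.

Lemma ccc_subset d (X : porderType d) (S : set X) : ccc X -> ccc (set_type S).
Proof.
move=> Xccc A Aanti; apply: (@countable_image_inj _ _ (val : set_type S -> X)).
  by move=> u v _ _; exact: val_inj.
apply: Xccc => _ _ /set_mem[u Au <-] /set_mem[v Av <-] uv.
apply: Aanti; rewrite ?inE//.
Qed.

Section RecordSet.
Context d (X : porderType d) (r : rel X).
Hypothesis rwo : well_order r.

(** As [r] is total, [~~ r x y] says that [y] comes strictly before [x]. *)
Definition record_set : set X := [set x | forall y, ~~ r x y -> ~ x <= y].

(** Take the [r]-least point above [x]: whatever lies above it also lies above [x]. *)
Lemma record_set_cofinal (x : X) : exists2 s, record_set s & x <= s.
Proof.
have [|s [[xs smin] _]] := @rwo [pred y | x <= y].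
  by exists x; rewrite inE.
rewrite inE in xs; exists s => // y /negP nsy sy; apply/nsy/smin.
by rewrite inE; exact: le_trans sy.
Qed.

(** On records the order is contained in [r], so an [r]-least point is minimal. The root need not be
    a record and is treated apart. *)
Lemma record_set_founded (m : X) :
  (forall x, m <= x) -> founded (set_type ([set m] `|` record_set)).
Proof.
move=> mmin A [u Au].
have [[v [Av vm]]|nm] := pselect (exists v, A v /\ val v = m).
  exists v => // x _ /lt_geF/negP; apply.
  by have : val v <= val x by rewrite vm.
have Arec x : A x -> record_set (val x).
  move=> Ax; have /set_mem[xm|//] := valP x; case: nm; by exists x.
have [|s [[+ smin] _]] := @rwo [pred y | y \in val @` A].
  by exists (val u); rewrite !inE; exists u.
rewrite !inE => -[v Av vs]; exists v => // x Ax xv.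
have rvx : r (val v) (val x) by rewrite vs; apply: smin; rewrite !inE; exists x.
have rxv : r (val x) (val v).
  by apply: contrapT => /negP nr; exact: (Arec x Ax _ nr (ltW xv)).
have [[_ ranti] _] := well_order_total_order rwo.
have vx : v = x by apply/val_inj/ranti; rewrite rvx rxv.
by rewrite vx ltxx in xv.
Qed.
End RecordSet.

Theorem theorem6p7 (R : realType) (d : Order.disp_t) (X : porderType d) :
  ccc X ->
  branchwise_real R X ->
  ~ (exists l : X -> R, continuous_grading l) ->
  exists S : set X, suslin_tree (set_type S).
Proof.
move=> Xccc Xbr nograd.
have [[[m mmin] Xtot] _ _] := Xbr.
have [r rwo] := well_ordering_principle X.
(* The root supplies the minimum that a tree order requires. *)
pose S := [set m] `|` record_set r; exists S.
have Sf : founded (set_type S) by exact: record_set_founded.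
apply: suslin_treeI => //.
- exact: ccc_subset.
- split; last by move=> x u v; exact: (Xtot (val x)).
  have mS : m \in S by apply: mem_set; left.
  by exists (SigSub mS) => x; exact: mmin.
- by move=> C; exact: (chain_countable Xbr).
- move=> /countable_set_type cS; apply: nograd.
  apply: (countable_cofinal_grading Xbr cS) => x.
  by have [s rs xs] := record_set_cofinal rwo x; exists s => //; right.
Qed.
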